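(* The operations $s$ and $s'$ (defined in the context) take constant time on the average. That is, there is a constant $K$ such that for every $n\ge1$, the average running time of $s$, and likewise of $s'$, over all inputs representing natural numbers of bitsize $n$ (taken uniformly) is at most $K$.
   Context: Let $T$ be the set of finite ordered rooted binary trees with empty leaves: $e$ is the empty tree and $c(x,y)$ is the tree with left subtree $x$ and right subtree $y$; $c'$ is the inverse of $c$ on nonempty trees. Put $u=c(e,e)$. Parity is defined recursively: $e$ is even; $c(x,y)$ is even iff $y$ is odd, and odd iff $y$ is even. A tree $t$ represents the natural number $N(t)$ given by $N(e)=0$ and $N(c(x,y))=2^{N(x)+1}N(y)$ if $N(y)$ is odd, $N(c(x,y))=2^{N(x)+1}(N(y)+1)-1$ if $N(y)$ is even; $N$ is a bijection $T\to\mathbb{N}$. A natural number $m\geq 1$ has bitsize $n$ if $2^{n-1}\le m<2^n$. The functions $s$ (on $T$) and $s'$ (on $T\setminus\{e\}$) are defined by mutual recursion; in each list the first applicable rule is used. Definition of $s$: $s(e)=u$; $s(c(x,e))=c(x,u)$; for an even argument $\neq e$: $s(c(e,c(x,y)))=c(s(x),y)$, and otherwise $s(c(x,y))=c(e,c(s'(x),y))$; for an odd argument: $s(c(x,c(e,c(y,z))))=c(x,c(s(y),z))$, and otherwise $s(c(x,c(y,z)))=c(x,c(e,c(s'(y),z)))$. Definition of $s'$: $s'(u)=e$; $s'(c(x,u))=c(x,e)$; for an even argument: $s'(c(x,c(e,c(y,z))))=c(x,c(s(y),z))$, and otherwise $s'(c(x,c(y,z)))=c(x,c(e,c(s'(y),z)))$;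 for an odd argument: $s'(c(e,c(x,z)))=c(s(x),z)$, and otherwise $s'(c(x,y))=c(e,c(s'(x),y))$. Cost model: applying $c$ or $c'$, testing equality with $e$ or $u$, and testing parity each take constant time; running time is measured by the total number of (recursive) calls to $s$ and $s'$ made during the evaluation, including the initial one. *)

(* Defs.v *)
From HB Require Import structures.
From mathcomp Require Import all_boot all_order all_algebra.
From mathcomp Require Import zify.

Set Implicit Arguments.
Unset Strict Implicit.
Unset Printing Implicit Defensive.

Import GRing.Theory Num.Theory.

Inductive tree : Type := e | c of tree & tree.

Definition tree_eq_dec (x y : tree) : {x = y} + {x <> y}.
Proof. decide equality. Defined.

HB.instance Definition _ := hasDecEq.Build tree (compareP tree_eq_dec).

Definition u : tree := c e e.

Fixpoint odd_tree (t : tree) : bool :=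
  if t is c _ y then ~~ odd_tree y else false.

Definition even_tree (t : tree) : bool := ~~ odd_tree t.

Fixpoint N (t : tree) : nat :=
  match t with
  | e => 0
  | c x y => if odd (N y) then 2 ^ (N x).+1 * N y
             else 2 ^ (N x).+1 * (N y).+1 - 1
  end.

(* The result of a call whose rule makes one further call with outcome
   [p = (value, number of calls)] and wraps that value in [f]. *)
Definition call (f : tree -> tree) (p : tree * nat) : tree * nat :=
  (f p.1, p.2.+1).

(* [s_run t] and [s'_run t] pair the value of s (resp. s') at t with the number
   of calls to s and s' made in the evaluation, the initial one included.
   The first-match order of the branches is the order of the rules.  s' is
   undefined at e: [s'_run e] is a dummy, and no evaluation of s, or of s' at a
   nonempty tree, calls it: a nonempty tree has the parity opposite to that of
   its right subtree, so in an odd [c x (c e z)] the tree [z] is nonempty, and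
   in an even [c x (c e z)] other than [c x u] likewise. *)
Fixpoint s_run (t : tree) : tree * nat :=
  match t with
  | e => (u, 1)
  | c x e => (c x u, 1)
  | c x (c y z) =>
      if even_tree t then
        match x with
        | e => call (fun r => c r z) (s_run y)
        | c _ _ => call (fun r => c e (c r (c y z))) (s'_run x)
        end
      else
        match y, z with
        | e, c y' z' => call (fun r => c x (c r z')) (s_run y')
        | _, _ => call (fun r => c x (c e (c r z))) (s'_run y)
        end
  end
with s'_run (t : tree) : tree * nat :=
  match t with
  | e => (e, 1)
  | c e e => (e, 1)
  | c x (c e e) => (c x e, 1)
  | c x (c y z) =>
      if even_tree t then
        match y, z with
        | e, c y' z' => call (fun r => c x (c r z')) (s_run y')
        | _, _ => call (fun r => c x (c e (c r z))) (s'_run y)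
        end
      else
        match x with
        | e => call (fun r => c r z) (s_run y)
        | c _ _ => call (fun r => c e (c r (c y z))) (s'_run x)
        end
  | c x e => call (fun r => c e (c r e)) (s'_run x)
  end.

Definition s (t : tree) : tree := (s_run t).1.
Definition s' (t : tree) : tree := (s'_run t).1.
Definition s_cost (t : tree) : nat := (s_run t).2.
Definition s'_cost (t : tree) : nat := (s'_run t).2.

Definition has_bitsize (n m : nat) : bool := 2 ^ n.-1 <= m < 2 ^ n.

Fixpoint trees_upto (h : nat) : seq tree :=
  if h is h'.+1 then
    e :: [seq c x y | x <- trees_upto h', y <- trees_upto h']
  else [:: e].

(* The height of t is at most N t, so [trees_upto (2 ^ n)] misses no tree
   representing a number of bitsize n: see [mem_inputs]. *)
Definition inputs (n : nat) : seq tree :=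
  undup [seq t <- trees_upto (2 ^ n) | has_bitsize n (N t)].

Lemma N_c_gt x y : (N x < N (c x y)) && (N y < N (c x y)).
Proof.
have : (N x).+1 < 2 ^ (N x).+1 by apply: ltn_expl.
rewrite /=; move: (N x) (N y) (2 ^ _) => m k p lt_m_p.
case: ifP => oddk; last by apply/andP; split; nia.
have k_gt0 : 0 < k by case: k oddk.
by apply/andP; split; nia.
Qed.

Lemma trees_uptoP h t : N t <= h -> t \in trees_upto h.
Proof.
elim: h t => [|h IHh] [|x y] //; have /andP[lt_x lt_y] := N_c_gt x y; first lia.
move=> le_h; rewrite inE /=; apply/allpairsP.
by exists (x, y); split=> //=; apply: IHh; lia.
Qed.

Lemma mem_inputs n t : (t \in inputs n) = has_bitsize n (N t).
Proof.
rewrite mem_undup mem_filter andb_idr // => /andP[_ /ltnW le_t].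
exact: trees_uptoP.
Qed.

Lemma inputs_uniq n : uniq (inputs n).
Proof. exact: undup_uniq. Qed.

Definition average (f : tree -> nat) (r : seq tree) : rat :=
  ((\sum_(t <- r) f t)%:R / (size r)%:R)%R.

(* Main.v *)
(** A number of bitsize [n] is a sequence of alternating blocks of equal bits,
  and [N (c x y)] is [N y] with a block of length [N x + 1] appended at its low
  end.  A call to s or s' makes at most one further call, on a tree whose value
  is smaller than the length of one of the three lowest blocks; as each call
  decreases the value, its cost is at most one more than the total length of
  these blocks.  Of the two numbers [2 m] and [2 m + 1], one lengthens the
  lowest block of [m] by one bit and the other starts a new block of length 1,
  so the average total length of the [j] lowest blocks is at most [2 j]. *)
Require Import Defs.
From HB Require Import structures.
From mathcomp Require Import all_boot all_order all_algebra.
From mathcomp Require Import zify.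

Import Order.TTheory GRing.Theory Num.Theory.

Lemma odd_treeE t : odd_tree t = odd (N t).
Proof.
elim: t => //= x _ y ->; case: ifP => odd_y.
  by rewrite oddM oddX.
by rewrite oddB ?muln_gt0 ?expn_gt0 // oddM oddX.
Qed.

Lemma odd_N_c x y : odd (N (c x y)) = ~~ odd (N y).
Proof. by rewrite -!odd_treeE. Qed.

(** Unites both cases of [N]: the right factor is odd, so this splits a number into a power of two
    and an odd part. *)
Lemma N_c_half x y :
  N (c x y) + ~~ odd (N y) = 2 ^ (N x).+1 * (N y + ~~ odd (N y)).
Proof.
have := expn_gt0 2 (N x).+1.
by rewrite /=; case: ifP => _ /=; move: (2 ^ _) (N y) => p k; nia.
Qed.

(** The parity of [N (c x y)] gives that of [N y]; in [N_c_half] the 2-adic valuation then gives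
    [N x], and the odd part gives [N y]. *)
Lemma N_inj : injective N.
Proof.
elim=> [|x IHx y IHy] [|x' y'] //.
- by have /andP[] := N_c_gt x' y' => + _ E; rewrite -E.
- by have /andP[] := N_c_gt x y => + _ E; rewrite E.
move=> E; have Eodd : odd (N y) = odd (N y').
  by move/(congr1 odd): (E); rewrite !odd_N_c => /negb_inj.
have := N_c_half x y; rewrite E Eodd N_c_half -Eodd => Epow.
have odd_half z : odd (N z + ~~ odd (N z)) by rewrite oddD; case: odd.
have log_half z k : logn 2 (2 ^ k * (N z + ~~ odd (N z))) = k.
  rewrite lognM ?expn_gt0 ?(odd_gt0 (odd_half _)) // pfactorK //.
  by rewrite [logn 2 (_ + _)]logn_coprime ?addn0 // coprime2n odd_half.
have Ex : N x = N x'.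
  have := congr1 (logn 2) Epow.
  by rewrite log_half Eodd log_half => -[].
move/eqP: Epow; rewrite Ex eqn_pmul2l ?expn_gt0 // eqn_add2r => /eqP Ey.
by rewrite (IHx _ Ex) (IHy _ (esym Ey)).
Qed.

(** The appended bit differs from the lowest bit of [N t]. *)
Lemma N_new_block t : N (c e t) = (N t).*2 + ~~ odd (N t).
Proof. by rewrite /= expn1; case: ifP => _ /=; lia. Qed.

(** One more factor 2 in [N_c_half]: the appended bit repeats the lowest one. *)
Lemma N_longer_block x x' y :
  N x' = (N x).+1 -> N (c x' y) = (N (c x y)).*2 + odd (N (c x y)).
Proof.
move=> Ex; have := N_c_half x y; have := N_c_half x' y.
rewrite odd_N_c Ex (expnS 2 (N x).+1) -mulnA.
by move: (N (c x' y)) (N (c x y)) ((2 ^ (N x).+1) * _) => k' k p; lia.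
Qed.

(** The lowest bit of [m], appended to the tree of [m./2], either starts a new block or lengthens
    the lowest one. *)
Lemma N_surj m : {t | N t = m}.
Proof.
elim: m {-2}m (leqnn m) => [|n IHn] m le_mn; first by exists e => /=; lia.
have [m0|m_gt0] := posnP m; first by exists e.
have Em := odd_double_half m; have le_half : m./2 <= n by lia.
have [t Et] := IHn _ le_half.
have [bit_m|bit_m] := eqVneq (odd m) (odd (N t)); last first.
  by exists (c e t); rewrite N_new_block Et; move: bit_m; rewrite Et; lia.
case: t Et bit_m => [|x y] Et bit_m.
  by exfalso; rewrite /= in Et bit_m; lia.
have /andP[lt_x _] := N_c_gt x y.
(* The induction applies to [(N x).+1] because [N x < m./2]. *)
have [x' Ex'] : {x' | N x' = (N x).+1} by apply: IHn; lia.
by exists (c x' y); rewrite (N_longer_block _ _ _ Ex') -bit_m Et; lia.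
Qed.

Definition tree_of m : tree := sval (N_surj m).

Lemma tree_ofK : cancel tree_of N.
Proof. by move=> m; rewrite /tree_of; case: N_surj. Qed.

Lemma NK : cancel N tree_of.
Proof. by move=> t; apply: N_inj; rewrite tree_ofK. Qed.

Fixpoint blocks_size (j : nat) (t : tree) : nat :=
  match j, t with
  | j'.+1, c x y => (N x).+1 + blocks_size j' y
  | _, _ => 0
  end.

(** A block of length [l] brings a factor [2 ^ l > l]. This weakens the bound of [cost_le] to
    [(N t).+1], the form its induction uses. *)
Lemma blocks_size_le j t : blocks_size j t <= N t.
Proof.
elim: t j => [|x _ y IHy] [|j] //; rewrite [blocks_size _ _]/=.
have := IHy j; have := N_c_half x y.
have : (N x).+1 < 2 ^ (N x).+1 by apply: ltn_expl.
have : 0 < N y + ~~ odd (N y) by case: (N y).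
move: (2 ^ _) (N (c x y)) => p k; nia.
Qed.

(* s and s' share two rules on c(x,c(y,z)): one moves the border between the
   two lowest blocks, the other the border between the next two. *)
Definition low_rule x y z : tree * nat :=
  if x is e then call (fun r => c r z) (s_run y)
  else call (fun r => c e (c r (c y z))) (s'_run x).

Definition high_rule x y z : tree * nat :=
  match y, z with
  | e, c y' z' => call (fun r => c x (c r z')) (s_run y')
  | _, _ => call (fun r => c x (c e (c r z))) (s'_run y)
  end.

Lemma s_runE x y z : s_run (c x (c y z)) =
  if even_tree (c x (c y z)) then low_rule x y z else high_rule x y z.
Proof. by []. Qed.

Lemma s'_runE x y z : c y z <> u -> s'_run (c x (c y z)) =
  if even_tree (c x (c y z)) then high_rule x y z else low_rule x y z.
Proof. by case: x y z => [|x1 x2] [|y1 y2] [|z1 z2]. Qed.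

Lemma low_rule_cost x y z :
  (low_rule x y z).2 = (if x is e then (s_run y).2 else (s'_run x).2).+1.
Proof. by case: x. Qed.

Lemma high_rule_cost x y z :
  (high_rule x y z).2 =
  (match y, z with
   | e, c y' _ => (s_run y').2
   | _, _ => (s'_run y).2
   end).+1.
Proof. by case: y z => [|y1 y2] [|z1 z2]. Qed.

Lemma s'_cost_u x : (s'_run (c x u)).2 = 1.
Proof. by case: x. Qed.

Lemma cost_le t :
  (s_cost t <= (blocks_size 3 t).+1) && (s'_cost t <= (blocks_size 3 t).+1).
Proof.
rewrite /s_cost /s'_cost.
elim: {t}(N t) {-2}t (leqnn (N t)) => [|n IHn] t le_tn.
  by case: t le_tn => // x y; have := N_c_gt x y; lia.
(* The weak bound suffices for the further call: the value of its argument plus one is the length of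
   a block of [t]. *)
have IH r : N r < N t ->
    ((s_run r).2 <= (N r).+1) && ((s'_run r).2 <= (N r).+1).
  by have := blocks_size_le 3 r; have := IHn r; lia.
case: t {le_tn} IH => [|x [|y z]] // IH.
  have := IH x; have /andP[lt_x _] := N_c_gt x e.
  by case: x lt_x {IH} => [|x1 x2] lt_x /(_ lt_x) //=; lia.
have /andP[lt_x lt_yz] := N_c_gt x (c y z).
have /andP[lt_y lt_z] := N_c_gt y z.
have /andP[_ le_s'x] := IH x lt_x.
have /andP[le_sy le_s'y] := IH y (ltn_trans lt_y lt_yz).
have -> : blocks_size 3 (c x (c y z))
  = (N x).+1 + ((N y).+1 + blocks_size 1 z) by [].
set B := _ + _.
have low_le : (low_rule x y z).2 <= B.+1.
  rewrite low_rule_cost {}/B; move: (N x) (s'_run x) le_s'x => k p.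
  by case: x {lt_x lt_yz IH} => [|_ _]; lia.
have high_le : (high_rule x y z).2 <= B.+1.
  (* When [y = e], the call may go to the left subtree of [z], which encodes the third block. *)
  have le_third y' z' : z = c y' z' -> (s_run y').2 <= blocks_size 1 z.
    move=> Ez; have := N_c_gt y' z'; rewrite -Ez => /andP[lt_y' _].
    have /andP[] := IH y' (ltn_trans lt_y' (ltn_trans lt_z lt_yz)).
    by rewrite Ez /= addn0.
  rewrite high_rule_cost {low_le}/B; move: (blocks_size 1 z) le_third => b.
  move: (N y) (s'_run y) le_s'y => k p.
  by case: y z {lt_x lt_y lt_z lt_yz le_sy IH} => [|_ _] [|z1 z2] ? third;
    try have := third _ _ erefl; lia.
have [yz_u|yz_neq_u] := eqVneq (c y z) u.
  have -> : (s'_run (c x (c y z))).2 = 1 by rewrite yz_u s'_cost_u.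
  by rewrite s_runE andbT; case: ifP.
rewrite s_runE (s'_runE _ _ _ (elimN eqP yz_neq_u)).
by case: ifP => _; rewrite low_le high_le.
Qed.

Lemma sum_pairs F a b : \sum_(a.*2 <= m < b.*2) F m =
  \sum_(a <= m < b) (F m.*2 + F m.*2.+1).
Proof.
have [le_ba|/ltnW le_ab] := leqP b a; first by rewrite !big_geq ?leq_double.
elim: b le_ab => [|b IHb]; first by rewrite leqn0 => /eqP ->; rewrite !big_geq.
rewrite leq_eqVlt => /predU1P[->|]; first by rewrite !big_geq.
rewrite ltnS => le_ab; rewrite doubleS !big_nat_recr ?leq_double //; last first.
  by rewrite leqW ?leq_double.
by rewrite IHb //= addnA.
Qed.

(** Lengthening the lowest block adds 1; a new block of length 1 leaves room for only [j] blocks of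
    [m]. Positivity of [m] provides a block to lengthen. *)
Lemma blocks_size_pair j m : 0 < m ->
  blocks_size j.+1 (tree_of m.*2) + blocks_size j.+1 (tree_of m.*2.+1) =
  2 + blocks_size j.+1 (tree_of m) + blocks_size j (tree_of m).
Proof.
move=> m_gt0; have := tree_ofK m; case: (tree_of m) => [|x y] Em.
  by rewrite /= in Em; lia.
set x' := tree_of (N x).+1; have Ex' : N x' = (N x).+1 by rewrite tree_ofK.
have new_block := N_new_block (c x y); have longer := N_longer_block _ _ y Ex'.
rewrite Em in new_block longer.
case: (odd m) new_block longer; rewrite addn0 addn1.
  by move=> + <- => <-; rewrite !NK /= Ex'; lia.
by move=> <- + => <-; rewrite !NK /= Ex'; lia.
Qed.

Lemma sum_blocks_size_le j n :
  \sum_(2 ^ n <= m < 2 ^ n.+1) blocks_size j (tree_of m) <= j.*2 * 2 ^ n.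
Proof.
elim: n j => [|n IHn] j.
  rewrite expn0 expn1 big_nat1.
  have := blocks_size_le j (tree_of 1); rewrite tree_ofK.
  by case: j => [|j]; last lia; case: tree_of.
case: j => [|j]; first by rewrite big1 // => m _; case: tree_of.
rewrite (expnS 2 n.+1) [in X in X <= _]expnS !mul2n sum_pairs.
rewrite big_nat (eq_bigr (fun m => 2 + blocks_size j.+1 (tree_of m)
    + blocks_size j (tree_of m))); last first.
  move=> m /andP[le_m _].
  by rewrite blocks_size_pair // (leq_trans _ le_m) ?expn_gt0.
(* With [p = 2 ^ n], the bound reproduces itself: [2 * p + 2 * (j + 1) * p + 2 * j * p = 2 * (j + 1)
   * (2 * p)]. *)
have := IHn j; have := IHn j.+1; rewrite !expnS !mul2n.
set F := blocks_size j.+1; rewrite -big_nat !big_split /= sum_nat_const_nat.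
set a := \sum_(_ <= _ < _) F _; set b := \sum_(_ <= _ < _) _.
by move: a b (2 ^ n) => a b p; nia.
Qed.

Lemma perm_inputs n :
  perm_eq (inputs n.+1) (map tree_of (index_iota (2 ^ n) (2 ^ n.+1))).
Proof.
apply: uniq_perm; first exact: inputs_uniq.
  by rewrite map_inj_uniq ?iota_uniq //; apply: can_inj tree_ofK.
move=> t; rewrite mem_inputs /has_bitsize /= -[t in RHS]NK.
by rewrite mem_map ?mem_index_iota //; apply: can_inj tree_ofK.
Qed.

Local Open Scope ring_scope.

(** The constant is [1 + 2 * 3]: three blocks have average total length at most 6. *)
Lemma average_le (f : tree -> nat) (n : nat) :
  (forall t, f t <= (blocks_size 3 t).+1)%N -> average f (inputs n.+1) <= 7%:R.
Proof.
move=> le_f; rewrite /average.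
have -> : size (inputs n.+1) = (2 ^ n)%N.
  by rewrite (perm_size (perm_inputs n)) size_map size_iota expnS; lia.
rewrite ler_pdivrMr ?ltr0n ?expn_gt0 // -natrM ler_nat.
rewrite (perm_big _ (perm_inputs n)) big_map.
move: (blocks_size 3) le_f (sum_blocks_size_le 3 n) => size3 le_f le_sum.
have /leq_trans -> // : (\sum_(2 ^ n <= m < 2 ^ n.+1) f (tree_of m) <=
  \sum_(2 ^ n <= m < 2 ^ n.+1) (1 + size3 (tree_of m)))%N.
  by apply: leq_sum => m _; apply: le_f.
rewrite big_split /= sum_nat_const_nat; move: le_sum; rewrite expnS.
set a := (\sum_(_ <= _ < _) _)%N.
by move: a (2 ^ n)%N => a p; nia.
Qed.

Theorem proposition6 :
  exists K : rat, forall n : nat, (1 <= n)%N ->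
    average s_cost (inputs n) <= K /\ average s'_cost (inputs n) <= K.
Proof.
exists 7%:R => -[//|n] _; split; apply: average_le => t.
  by have /andP[] := cost_le t.
by have /andP[] := cost_le t.
Qed.
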